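(* Let $d\geq 1$, $r\geq d+1$, $1\leq m\leq r$ and $m\leq k\leq \min\{m+d,r\}$ be integers. Let $V$ be a finite set with $|V|\geq \max\{m+d,r\}$. Let $X$ be a $d$-Leray simplicial complex on vertex set $V$, and let $M$ be a matroid of rank $r$ on $V$ with rank function $\rho$. Assume that for every set $U=\{u_1,\ldots,u_{d+1},v_1,\ldots,v_{m-1}\}\subset V$ (of $d+m$ distinct elements) with $\rho(U)\geq k$, either $\{u_1,\ldots,u_{d+1}\}\in X$ or there exists $j\in\{1,\ldots,m-1\}$ such that $\sigma\cup\{v_j\}\in X$ for every $\sigma\subsetneq \{u_1,\ldots,u_{d+1}\}$. Then there is some $\tau\in X$ such that $\rho(V\setminus\tau)\leq k-1$.
   Context: A simplicial complex $X$ on vertex set $V$ is a family of subsets of the finite set $V$ closed under taking subsets. For $U\subset V$, the induced subcomplex is $X[U]=\{\sigma\in X:\sigma\subset U\}$. $X$ is $d$-Leray if every induced subcomplex $X[U]$ (including $X$ itself) has trivial reduced homology $\tilde H_i$ for all $i\geq d$. For a matroid $M$ on $V$, the rank function $\rho$ assigns to $W\subset V$ the maximum size of an independent subset of $W$; the rank of $M$ is $\rho(V)$. *)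

(* Defs.v *)
From HB Require Import structures.
From mathcomp Require Import all_boot all_order all_algebra.

Set Implicit Arguments.
Unset Strict Implicit.
Unset Printing Implicit Defensive.

Import GRing.Theory.
Local Open Scope ring_scope.

Section SimplicialComplex.
Variable V : finType.
Implicit Types (X : {set {set V}}) (U s t : {set V}).

(* Singletons need not be faces; the empty family is not excluded. *)
Definition simplicial_complex X : Prop :=
  forall s t, s \in X -> t \subset s -> t \in X.

Definition induced X U : {set {set V}} := [set s in X | s \subset U].

Section Homology.
Variable F : fieldType.

(* A chain assigns a coefficient to each subset of V; F^o is F as an F-module. *)
Notation chain := {ffun {set V} -> F^o}.

(* Faces are oriented by the enumeration order of V. *)
Definition position (v : V) (s : {set V}) : nat :=
  #|[set w in s | (enum_rank w < enum_rank v)%N]|.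

(* Coefficient form of [x_0, ..., x_n] |-> \sum_j (-1)^j [x_0, ..., x_n without
   x_j]; see boundary_face_chain. Points are sent to the empty face, so that the
   chain complex is the augmented one. *)
Definition boundary_fun (c : chain) : chain :=
  [ffun t : {set V} =>
    \sum_(v | v \notin t) (-1) ^+ position v (v |: t) * c (v |: t)].

Fact boundary_fun_is_linear : linear boundary_fun.
Proof.
move=> a c e; apply/ffunP=> t; rewrite !ffunE scaler_sumr -big_split /=.
apply: eq_bigr => v _; rewrite !ffunE mulrDr; congr (_ + _).
by rewrite /GRing.scale /= mulrCA.
Qed.

HB.instance Definition _ :=
  GRing.isLinear.Build F chain chain *:%R boundary_fun boundary_fun_is_linear.

Definition boundary : 'End(chain) := linfun boundary_fun.

Definition face_chain s : chain := [ffun t : {set V} => (t == s)%:R].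

Lemma boundary_face_chain s :
  boundary (face_chain s)
  = \sum_(v in s) (-1) ^+ position v s *: face_chain (s :\ v).
Proof.
apply/ffunP=> t; rewrite lfunE /= ffunE sum_ffunE.
rewrite big_mkcond [RHS]big_mkcond /=; apply: eq_bigr => v _.
have [vt|vt] /= := boolP (v \in t).
  case: ifP => // _; rewrite !ffunE; case: eqP => [tE|_].
    by move: vt; rewrite tE !inE eqxx.
  by rewrite scaler0.
rewrite ffunE; have [<-|ne] := eqVneq (v |: t) s.
  by rewrite setU11 !ffunE setU1K // eqxx.
rewrite mulr0; case: ifP => // vs; rewrite !ffunE.
case: eqP => [tE|_]; last by rewrite scaler0.
by move: ne; rewrite tE setD1K // eqxx.
Qed.

(* Indexed by cardinality: chains X n has degree n - 1, so that the empty face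
   (degree -1) is covered. *)
Definition chains X (n : nat) : {vspace chain} :=
  <<[seq face_chain s | s <- enum X & #|s| == n]>>%VS.

Definition cycles X n : {vspace chain} := (chains X n :&: lker boundary)%VS.

Definition boundaries X n : {vspace chain} := (boundary @: chains X n.+1)%VS.

(* The quotient of i-cycles by i-boundaries is zero. *)
Definition reduced_homology_trivial X (i : nat) : Prop :=
  (cycles X i.+1 <= boundaries X i.+1)%VS.

Definition Leray (d : nat) X : Prop :=
  forall U i, (d <= i)%N -> reduced_homology_trivial (induced X U) i.

End Homology.
End SimplicialComplex.

Record matroid (V : finType) := Matroid {
  indep : {set {set V}};
  indep0 : set0 \in indep;
  indepS : forall I J : {set V}, J \in indep -> I \subset J -> I \in indep;
  indep_exchange : forall I J : {set V}, I \in indep -> J \in indep ->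
    (#|I| < #|J|)%N -> exists2 x, x \in J :\: I & x |: I \in indep
}.

Definition rank (V : finType) (M : matroid V) (W : {set V}) : nat :=
  \max_(I in indep M | I \subset W) #|I|.

(* Main.v *)
Require Import Defs.
From mathcomp Require Import all_boot all_order all_algebra.
From mathcomp Require Import zify ring.

(* Suppose that every face t of X satisfies rank (V \ t) >= k. For faces r <= s
   of X we choose a chain f r s of X, of dimension n = |s \ r| and avoiding r,
   such that f is a chain map on the cubical complex whose cells are the
   intervals [r, s]. This is done by induction on n. For n <= d one fills inside
   the matroid of the sets u with |u| <= rank u + (m + d - k), whose restriction
   to V \ r is acyclic in the relevant degrees and whose independent sets of
   size at most d are faces of X by hypothesis; for n = d, a simplex u of the
   filling that is not a face of X is replaced by the cone from some v_j over
   the boundary of u. For n > d one fills with the Leray property. The cells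
   [v, s], v in s, subdivide the simplex s, and their images do not contain s,
   while the cells [set0, s] give a null-homotopy of this fixed-point-free chain
   map. Comparing traces (a Lefschetz argument) gives 0 = 1. *)

Set Implicit Arguments.
Unset Strict Implicit.
Unset Printing Implicit Defensive.

Lemma exists_subset_card (V : finType) (A : {set V}) n :
  n <= #|A| -> exists2 B : {set V}, B \subset A & #|B| = n.
Proof.
move=> /card_geqP[s [us cs sA]]; exists [set x in s].
  by apply/subsetP=> x; rewrite inE; apply: sA.
by rewrite cardsE (card_uniqP us).
Qed.

(** * Signs, cones and links of simplicial chains *)

Section Chains.
Import GRing.Theory.
Local Open Scope ring_scope.
Variables (V : finType) (F : fieldType).
Implicit Types (r s t W : {set V}) (v w : V).

Local Notation chain := {ffun {set V} -> F^o}.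
Local Notation bd := (boundary V F).
Implicit Types c z : chain.

Lemma enum_rank_total v w : v != w ->
  (enum_rank w < enum_rank v)%N = ~~ (enum_rank v < enum_rank w)%N.
Proof.
move=> ne; rewrite -leqNgt [RHS]leq_eqVlt; case: eqP => // /val_inj/enum_rank_inj e.
by rewrite e eqxx in ne.
Qed.

(** The terms for [(v, w)] and [(w, v)] cancel. Splitting by the enumeration order, rather than
    showing that the sum is its own opposite, also covers groups with 2-torsion, hence
    characteristic 2. *)
Lemma sum_antisym (D : {set V}) (U : zmodType) (G : V -> V -> U) :
  (forall v w, v \in D -> w \in D -> v != w -> G v w = - G w v) ->
  \sum_(v in D) \sum_(w in D :\ v) G v w = 0.
Proof.
move=> GN.
have -> : \sum_(v in D) \sum_(w in D :\ v) G v w =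
    \sum_(v in D) \sum_(w in D | (enum_rank w < enum_rank v)%N) G v w
  + \sum_(v in D) \sum_(w in D | (enum_rank v < enum_rank w)%N) G v w.
  rewrite -big_split /=; apply: eq_bigr => v _.
  rewrite (bigID (fun w => enum_rank w < enum_rank v)%N) /=.
  congr (_ + _); apply: eq_bigl => w; rewrite !inE; have [->|ne] := eqVneq w v;
    by rewrite ?ltnn ?andbF // (enum_rank_total ne) ?negbK andTb.
rewrite [X in X + _](exchange_big_dep (mem D)) /=; last by move=> v w _ /andP[].
rewrite -big_split big1 //= => v vD.
rewrite (eq_bigl (fun w => (w \in D) && (enum_rank v < enum_rank w)%N)); last first.
  by move=> w; rewrite vD.
rewrite -big_split big1 //= => w /andP[wD lt_vw].
by rewrite GN ?addNr //; apply: contraTneq lt_vw => ->; rewrite ltnn.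
Qed.

Definition sgn v s : F := (-1) ^+ position v s.

Lemma sgnM v s : sgn v s * sgn v s = 1.
Proof. by rewrite -expr2 sqrr_sign. Qed.

Lemma positionD1 v w s : w \in s ->
  position v s = ((enum_rank w < enum_rank v) + position v (s :\ w))%N.
Proof.
move=> ws; rewrite /position (cardsD1 w) !inE ws /=; congr (_ + _)%N.
by apply: eq_card => x; rewrite !inE andbA.
Qed.

Lemma sgn_swap v w s : v \in s -> w \in s -> v != w ->
  sgn v s * sgn w (s :\ v) = - (sgn w s * sgn v (s :\ w)).
Proof.
move=> vs ws ne; rewrite /sgn (positionD1 v ws) (positionD1 w vs) !exprD.
by rewrite (enum_rank_total ne); case: (_ < _)%N => /=; ring.
Qed.

Lemma swap_scalars (a b p q x : F) :
  a * p = - (b * q) -> p * p = 1 -> b * b = 1 -> a * (b * x) = - (p * (q * x)).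
Proof.
move=> ap pp bb; rewrite -[LHS]mul1r -pp.
transitivity ((a * p) * (b * p * x)); first by ring.
rewrite ap; transitivity (- ((b * b) * (p * (q * x)))); first by ring.
by rewrite bb mul1r.
Qed.

Lemma boundaryE c t :
  bd c t = \sum_(v | v \notin t) sgn v (v |: t) * c (v |: t).
Proof. by rewrite lfunE /= ffunE. Qed.

Lemma boundary_nz c t : bd c t != 0 -> exists2 v, v \notin t & c (v |: t) != 0.
Proof.
rewrite boundaryE => nz.
have [/existsP[v /andP[vt cv]]|] := boolP [exists v, (v \notin t) && (c (v |: t) != 0)].
  by exists v.
rewrite negb_exists => /forallP h; move: nz; rewrite big1 ?eqxx // => v vt.
by have := h v; rewrite vt negbK => /eqP ->; rewrite mulr0.
Qed.

Lemma add_nz c z t : (c + z) t != 0 -> c t != 0 \/ z t != 0.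
Proof.
rewrite ffunE; have [->|] := eqVneq (c t) 0; last by left.
by rewrite add0r; right.
Qed.

Lemma opp_nz c t : (- c) t != 0 -> c t != 0.
Proof. by rewrite ffunE oppr_eq0. Qed.

Lemma scale_nz (a : F) c t : (a *: c) t != 0 -> c t != 0.
Proof.
by rewrite ffunE; apply: contraNneq => ->; rewrite scaler0.
Qed.

Lemma sum_nz (I : finType) (P : pred I) (f : I -> chain) t :
  (\sum_(i | P i) f i) t != 0 -> exists2 i, P i & f i t != 0.
Proof.
rewrite sum_ffunE => nz.
have [/existsP[i /andP[Pi fi]]|] := boolP [exists i, P i && (f i t != 0)].
  by exists i.
rewrite negb_exists => /forallP h; move: nz; rewrite big1 ?eqxx // => i Pi.
by have := h i; rewrite Pi negbK => /eqP.
Qed.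

Lemma face_nz s t : face_chain F s t != 0 -> t = s.
Proof. by rewrite ffunE; have [->|] := eqVneq t s; rewrite ?eqxx. Qed.

Lemma chain_sum c : c = \sum_t (c t : F) *: face_chain F t.
Proof.
apply/ffunP=> t; rewrite sum_ffunE (bigD1 t) //= big1 => [|s /negPf ne].
  by rewrite !ffunE eqxx addr0 /GRing.scale /= mulr1.
by rewrite !ffunE eq_sym ne scaler0.
Qed.

Lemma boundary_face0 : bd (face_chain F set0) = 0.
Proof. by rewrite boundary_face_chain big_set0. Qed.

Lemma boundary_boundary_face s : bd (bd (face_chain F s)) = 0.
Proof.
rewrite boundary_face_chain linear_sum /=.
under eq_bigr => v _.
  rewrite linearZ /= boundary_face_chain scaler_sumr.
  under eq_bigr => w _ do rewrite scalerA.
  over.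
apply: sum_antisym => v w vs ws ne.
by rewrite -/(sgn _ _) -/(sgn _ _) sgn_swap // scaleNr setDDl setUC -setDDl.
Qed.

(** Linear extension of [x_0, ..., x_n] |-> [v, x_0, ..., x_n], with the sign that sorts [v] into
    place; faces containing [v] are sent to 0. *)
Definition cone v c : chain :=
  [ffun t : {set V} => if v \in t then sgn v t * c (t :\ v) else 0].

(** Normalized so that [c] is [cone v (link v c)] plus the part of [c] on faces avoiding [v]. *)
Definition link v c : chain :=
  [ffun t : {set V} => if v \in t then 0 else sgn v (v |: t) * c (v |: t)].

Lemma cone_nz v c t : cone v c t != 0 -> v \in t /\ c (t :\ v) != 0.
Proof.
rewrite ffunE; case: ifP => [_ nz|]; rewrite ?eqxx //; split=> //.
by apply: contraNneq nz => ->; rewrite mulr0.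
Qed.

Lemma link_nz v c t : link v c t != 0 -> v \notin t /\ c (v |: t) != 0.
Proof.
rewrite ffunE; case: ifP => [_|_ nz]; rewrite ?eqxx //; split=> //.
by apply: contraNneq nz => ->; rewrite mulr0.
Qed.

Lemma boundary_cone v c : (forall t, c t != 0 -> v \notin t) ->
  bd (cone v c) = c - cone v (bd c).
Proof.
move=> cv; have c0 t : v \in t -> c t = 0.
  by move=> vt; apply: contraTeq vt => /cv.
apply/ffunP=> t; rewrite boundaryE !ffunE.
have [vt|vt] := boolP (v \in t).
  (* In [bd c (t :\ v)] the summand that adds [v] back is [c t = 0]; the others match those of the
     cone up to the order in which two vertices are removed. *)
  rewrite c0 // add0r boundaryE [X in _ * X](bigD1 v) /=; last by rewrite !inE eqxx.
  rewrite setD1K // c0 // mulr0 add0r mulr_sumr -sumrN.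
  apply: eq_big => [w|w wt].
    by rewrite !inE; case: eqVneq => [->|]; rewrite ?vt ?andbF ?andbT.
  have ne : w != v by apply: contraNneq wt => ->.
  rewrite ffunE !inE vt orbT.
  have e : (w |: t) :\ v = w |: (t :\ v).
    by apply/setP=> x; rewrite !inE; case: (eqVneq x w) => [->|]; rewrite ?ne.
  have := @sgn_swap w v (w |: t); rewrite setU1K // e !inE eqxx vt orbT.
  move=> /(_ isT isT ne) sw.
  exact: swap_scalars sw (sgnM v t) (sgnM v (w |: t)).
rewrite subr0 (bigD1 v) //= ffunE setU11 setU1K // mulrA sgnM mul1r.
rewrite big1 ?addr0 // => w /andP[wt ne]; rewrite ffunE !inE (negPf vt) orbF.
by rewrite eq_sym (negPf ne) mulr0.
Qed.

(** With [b] the part of [z] avoiding [v], [boundary_cone] turns [bd z = 0] into [link v z - cone v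
    (bd (link v z)) + bd b = 0]. Only the cone lives on faces containing [v], so reading
    coefficients there kills [bd (link v z)], and the rest is the second claim. *)
Lemma boundary_link v z : bd z = 0 ->
  bd (link v z) = 0 /\ bd [ffun t : {set V} => if v \in t then 0 else z t] = - link v z.
Proof.
move=> z0; set b := (X in _ /\ bd X = _).
have zE : z = cone v (link v z) + b.
  apply/ffunP=> t; rewrite !ffunE; case: ifP => vt; last by rewrite add0r.
  by rewrite !inE eqxx /= setD1K // mulrA sgnM mul1r addr0.
have lk t : link v z t != 0 -> v \notin t by case/link_nz.
have bv t : v \in t -> bd b t = 0.
  move=> vt; apply/eqP; apply: contraTT vt => /boundary_nz[w _].
  by rewrite ffunE !inE; case: (v \in t); rewrite ?orbT ?eqxx.
have dE : link v z - cone v (bd (link v z)) + bd b = 0.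
  by rewrite -boundary_cone // -raddfD /= -zE.
have d0 : bd (link v z) = 0.
  apply/ffunP=> t; rewrite [RHS]ffunE; have [vt|vt] := boolP (v \in t).
    apply/eqP; apply: contraTT vt => /boundary_nz[w _ /lk].
    by rewrite !inE negb_or => /andP[].
  have := congr1 (fun c : chain => c (v |: t)) dE.
  rewrite /= !ffunE setU11 bv ?setU11 // setU1K // addr0 sub0r.
  by move/eqP; rewrite oppr_eq0 mulf_eq0 signr_eq0 /= => /eqP.
split=> //; move: dE; rewrite d0.
have -> : cone v 0 = 0 by apply/ffunP=> t; rewrite !ffunE mulr0 if_same.
by rewrite subr0 addrC => /eqP; rewrite addr_eq0 => /eqP.
Qed.

End Chains.

(** * Matroid rank and elongations *)

Section Matroids.
Variables (V : finType).
Implicit Types (M : matroid V) (A B I J W u t : {set V}).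

Lemma rank_ge M I W : I \in indep M -> I \subset W -> #|I| <= rank M W.
Proof.
by move=> iI IW; rewrite /rank (leq_bigmax_cond (F := fun J => #|J|)) ?iI.
Qed.

Lemma rank_basis M W :
  exists I, [/\ I \in indep M, I \subset W & #|I| = rank M W].
Proof.
have [|I /andP[iI IW] e] := @eq_bigmax_cond _
    [pred I | (I \in indep M) && (I \subset W)] (fun I => #|I|).
  by apply/card_gt0P; exists set0; rewrite !inE indep0 sub0set.
by exists I; split=> //; rewrite /rank e.
Qed.

Lemma rank_leD M A B : A \subset B -> rank M B <= rank M A + #|B :\: A|.
Proof.
move=> AB; have [J [iJ JB <-]] := rank_basis M B.
rewrite -(cardsID A J) leq_add ?subset_leq_card ?setSD //.
by apply: rank_ge (subsetIr _ _); apply: indepS iJ (subsetIl _ _).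
Qed.

Lemma rank_lt_extend M A B : rank M A < rank M B ->
  exists2 x, x \in B :\: A & rank M A < rank M (x |: A).
Proof.
have [I [iI IA eI]] := rank_basis M A; have [J [iJ JB <-]] := rank_basis M B.
rewrite -eI => lt_IJ; have [x] := indep_exchange iI iJ lt_IJ.
rewrite inE => /andP[xI xJ] ixI; have cI : #|x |: I| = #|I|.+1 by rewrite cardsU1 xI.
exists x; last by rewrite -cI; apply: rank_ge (setUS _ IA).
rewrite inE (subsetP JB) // andbT; apply/negP=> xA.
have: #|x |: I| <= rank M A by apply: rank_ge; rewrite // subUset sub1set xA.
by rewrite cI -eI ltnn.
Qed.

Section Elongation.
Variables (M : matroid V) (e : nat).

(** The sets of nullity at most [e]: the independent sets of the elongation of [M] by [e]. *)
Definition elongation_indep : {set {set V}} := [set u : {set V} | #|u| <= rank M u + e].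

Fact elongation_indep0 : set0 \in elongation_indep.
Proof. by rewrite inE cards0. Qed.

Fact elongation_indepS I J :
  J \in elongation_indep -> I \subset J -> I \in elongation_indep.
Proof.
rewrite !inE => iJ IJ; have := rank_leD M IJ.
by have := cardsID I J; rewrite (setIidPr IJ); lia.
Qed.

Fact elongation_exchange I J :
  I \in elongation_indep -> J \in elongation_indep -> #|I| < #|J| ->
  exists2 x, x \in J :\: I & x |: I \in elongation_indep.
Proof.
rewrite !inE => iI iJ lt_IJ.
(* If the bound is tight at [I], then [J] has larger rank and the new element must raise the rank;
   if there is slack, any element of [J] outside [I] will do. *)
have [eq_I|lt_I] : #|I| = rank M I + e \/ #|I| < rank M I + e by lia.
  have [|x xJI lt_r] := @rank_lt_extend M I J; first by lia.
  by exists x => //; rewrite inE cardsU1; move: xJI; rewrite inE => /andP[-> _]; lia.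
have [x xJ xI] : exists2 x, x \in J & x \notin I.
  by apply/subsetPn; apply: contraL lt_IJ => /subset_leq_card; rewrite -leqNgt.
exists x; rewrite !inE ?xI // cardsU1 xI.
have : rank M I <= rank M (x |: I).
  have [K [iK KI <-]] := rank_basis M I.
  by apply: rank_ge (subset_trans KI (subsetUr _ _)).
lia.
Qed.

Definition elongation :=
  Matroid elongation_indep0 elongation_indepS elongation_exchange.

End Elongation.

Lemma indep_augment M I J : I \in indep M -> J \in indep M -> #|I| <= #|J| ->
  exists K, [/\ K \in indep M, I \subset K, K \subset I :|: J & #|K| = #|J|].
Proof.
move=> iI iJ; move En: (#|J| - #|I|) => n.
elim: n I iI En => [|n IH] I iI En le_IJ.
  by exists I; split; rewrite ?subsetUl //; lia.
have [|x] := indep_exchange iI iJ; first by lia.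
rewrite inE => /andP[xI xJ] ixI; have cI : #|x |: I| = #|I|.+1 by rewrite cardsU1 xI.
have [||K [iK sK KU cK]] := IH _ ixI; try by lia.
exists K; split=> //; first exact: subset_trans (subsetUr _ _) sK.
apply: subset_trans KU _; rewrite -setUA subUset sub1set inE xJ orbT /=.
exact: subxx.
Qed.

(** A large [W] contains an independent set of size [k], padded by [e] arbitrary elements; a small
    [W] has nullity at most [e] itself. *)
Lemma elongation_subset M e k W :
  k <= rank M W -> exists B, [/\ B \in indep (elongation M e), B \subset W
    & #|B| = minn #|W| (k + e)].
Proof.
move=> kW; have [le_W|lt_W] := leqP #|W| (k + e).
  by exists W; split=> //; rewrite inE; lia.
have [I [iI IW cI]] := rank_basis M W.
have : exists B, [/\ B \subset W, #|B| = k + e & k <= rank M B].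
  have [J JI cJ] : exists2 J : {set V}, J \subset I & #|J| = k.
    by apply: exists_subset_card; lia.
  have [L LW cL] : exists2 L : {set V}, L \subset W :\: J & #|L| = e.
    by apply: exists_subset_card; rewrite cardsDS ?(subset_trans JI IW) //; lia.
  move: LW; rewrite subsetD => /andP[LW dLJ].
  exists (J :|: L); split.
  - by rewrite subUset LW (subset_trans JI IW).
  - by rewrite cardsU disjoint_setI0 1?disjoint_sym // cards0; lia.
  rewrite -{1}cJ; apply: rank_ge (subsetUl _ _); exact: indepS iI JI.
by case=> B [BW cB kB]; exists B; split=> //; rewrite inE; lia.
Qed.

(** Augment [u] in the elongation up to size [k + e]; at that size, nullity at most [e] means rank
    at least [k]. *)
Lemma elongation_extend M e k W u :
  u \in indep (elongation M e) -> u \subset W -> #|u| <= k + e ->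
  k + e <= #|W| -> k <= rank M W ->
  exists B, [/\ u \subset B, B \subset W, #|B| = k + e & k <= rank M B].
Proof.
move=> iu uW le_u le_W kW; have [J [iJ JW cJ]] := elongation_subset e kW.
rewrite (minn_idPr le_W) in cJ.
have [|K [iK uK KU cK]] := indep_augment iu iJ; first by rewrite cJ.
exists K; split=> //.
- by apply: subset_trans KU _; rewrite subUset uW.
- by rewrite cK.
by move: iK; rewrite inE cK cJ leq_add2r.
Qed.

End Matroids.

(** * Acyclicity of matroid complexes *)

Section MatroidHomology.
Import GRing.Theory.
Local Open Scope ring_scope.
Variables (V : finType) (F : fieldType) (M : matroid V).
Implicit Types (A B W t : {set V}).

Local Notation chain := {ffun {set V} -> F^o}.
Local Notation bd := (boundary V F).
Implicit Types c z : chain.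

(* Deletion and contraction: the elements of A are contracted. For v in W, the
   link of v in z is filled over the contraction of v, which moves z off v; what
   remains is filled over the deletion of v, unless v is a coloop (in the degree
   considered), in which case it is filled by its cone from v. *)
Lemma matroid_acyclic A W n z :
  [disjoint A & W] -> bd z = 0 ->
  (forall t, z t != 0 -> [/\ t \subset W, A :|: t \in indep M & #|t| = n]) ->
  (exists B, [/\ B \subset W, A :|: B \in indep M & (n < #|B|)%N]) ->
  exists2 c, bd c = z &
    forall t, c t != 0 -> [/\ t \subset W, A :|: t \in indep M & #|t| = n.+1].
Proof.
move Em: #|W| => m; elim: m => [|m IH] in A W n z Em *.
  by move=> _ _ _ [B [/subset_leq_card]]; rewrite Em; lia.
move=> dAW z0 zS [B [BW iB nB]].
have [v vW] : exists v, v \in W by apply/card_gt0P; rewrite Em.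
have vA : v \notin A by apply: contraTN vW => /(disjointFr dAW) ->.
have EW : #|W :\ v| = m by move: Em; rewrite (cardsD1 v) vW; lia.
have dAv : [disjoint A & W :\ v] by apply: disjointWr dAW; apply: subD1set.
have subv t : t \subset W -> v \notin t -> t \subset W :\ v.
  by move=> tW vt; rewrite subsetD1 tW.
have sub_v t : t \subset W :\ v -> t \subset W.
  by move=> h; apply: subset_trans h (subD1set _ _).
(* If [v |: A] is dependent, [v] is a loop of the contraction by [A], so no admissible face contains
   it and it can be deleted. *)
have [iAv|iAv] := boolP (v |: A \in indep M); last first.
  have nov t : A :|: t \in indep M -> v \notin t.
    move=> iAt; apply: contraNN iAv => vt; apply: indepS iAt _.
    by rewrite subUset subsetUl sub1set inE vt orbT.
  have [t /zS[tW iAt ct]||c cz cS] := IH A (W :\ v) n z EW dAv z0.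
  - by split=> //; apply: subv => //; apply: nov.
  - by exists B; split=> //; apply: subv => //; apply: nov.
  by exists c => // t /cS[/sub_v].
pose a := link v z; pose b : chain := [ffun t : {set V} => if v \in t then 0 else z t].
have [a0 bE] := boundary_link v z0.
have [a' aE aS] : exists2 a', bd a' = a & forall t, a' t != 0 ->
    [/\ t \subset W :\ v, v |: (A :|: t) \in indep M & #|t| = n].
  (* For [n = 0] only the empty face can occur in [z], so the link is 0. *)
  case: n => [|n] in zS nB *.
    exists 0; last by move=> t; rewrite ffunE eqxx.
    rewrite linear0; apply/ffunP=> t; rewrite ffunE; apply/esym/eqP.
    by apply: contraT => /link_nz[vt /zS[_ _]]; rewrite cardsU1 vt.
  (* Removing [v |: A] from [K] leaves [#|B| - 1] elements, which is large enough for the link,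
     whose faces are one element smaller. *)
  have [|K [iK vK KU cK]] := indep_augment iAv iB.
    rewrite cardsU1 vA cardsU disjoint_setI0 ?cards0; first by lia.
    exact: disjointWr BW dAW.
  have dvA : [disjoint v |: A & W :\ v].
    by rewrite -setI_eq0 setIUl setU_eq0 !setI_eq0 dAv disjoints1 !inE eqxx.
  have [t /link_nz[vt /zS[tW iAt ct]]||c ca cS] := IH (v |: A) (W :\ v) n a EW dvA a0.
  - split; first by apply: subv => //; apply: subset_trans tW; apply: subsetUr.
      by rewrite -setUA setUCA.
    by move: ct; rewrite cardsU1 vt => -[].
  - exists (K :\: (v |: A)); split.
    + rewrite subDset; apply: subset_trans KU _; rewrite !subUset !sub1set.
      rewrite !inE eqxx /= subsetU ?subsetUr //=.
      apply/subsetP=> x xB; rewrite !inE (subsetP BW) // andbT.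
      by case: eqP; rewrite ?orbT.
    + by apply: indepS iK _; rewrite subUset vK subDset subsetUr.
    rewrite cardsDS // cK cardsU1 vA cardsU disjoint_setI0 ?cards0; first by lia.
    exact: disjointWr BW dAW.
  by exists c => // t /cS[? ? ->]; split=> //; rewrite setUA.
have a'v t : a' t != 0 -> v \notin t by case/aS; rewrite subsetD1 => /andP[].
(* Here [z] is [cone v a + b], and the boundary of [cone v a'] is [a' - cone v a]; adding it to [z]
   removes the part through [v]. *)
have zE : z = bd (- cone v a') + (b + a').
  rewrite linearN /= boundary_cone // aE -/a; apply/ffunP=> t; rewrite !ffunE.
  case: ifP => vt; last by ring.
  have -> : a' t = 0 by apply/eqP; apply: contraTT vt => /a'v.
  rewrite !inE eqxx /= setD1K // mulrA sgnM; ring.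
have z'0 : bd (b + a') = 0 by rewrite linearD /= bE aE addNr.
have z'S t : (b + a') t != 0 ->
    [/\ t \subset W :\ v, A :|: t \in indep M & #|t| = n].
  case/add_nz => [|/aS[tW iAt ct]]; last first.
    by split=> //; apply: indepS iAt (subsetUr _ _).
  rewrite ffunE; case: ifP => [|/negbT vt /zS[tW iAt ct]]; first by rewrite eqxx.
  by split=> //; apply: subv.
have cS' t : (- cone v a') t != 0 ->
    [/\ t \subset W, A :|: t \in indep M & #|t| = n.+1].
  case/opp_nz/cone_nz => vt /aS[tW iAt ct]; split.
  - by rewrite -(setD1K vt) subUset sub1set vW sub_v.
  - by rewrite -(setD1K vt) setUCA.
  - by rewrite (cardsD1 v) vt ct.
suff [c' c'E c'S] : exists2 c', bd c' = b + a' & forall t, c' t != 0 ->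
    [/\ t \subset W, A :|: t \in indep M & #|t| = n.+1].
  exists (- cone v a' + c'); first by rewrite linearD /= c'E -zE.
  by move=> t /add_nz[/cS'|/c'S].
have [/existsP[C /and3P[CW iC nC]]|noC] :=
    boolP [exists C : {set V}, [&& C \subset W :\ v, A :|: C \in indep M & (n < #|C|)%N]].
  have [||c cE cS] := IH A (W :\ v) n (b + a') EW dAv z'0 => //; first by exists C.
  by exists c => // t /cS[/sub_v].
exists (cone v (b + a')).
  rewrite boundary_cone ?z'0; last by move=> t /z'S[]; rewrite subsetD1 => /andP[].
  apply/ffunP=> t; rewrite !ffunE mulr0; case: ifP => _; exact: subr0.
move=> t /cone_nz[vt /z'S[tW iAt ct]]; split.
- by rewrite -(setD1K vt) subUset sub1set vW sub_v.
(* If [v] could not be added to [A :|: t], augmenting that set from [B] would give a [K] avoiding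
   [v], and [K :\: A] would be an independent set of the deletion with more than [n] elements. *)
- rewrite -(setD1K vt) setUCA; apply: contraNT noC => niv; apply/existsP.
  have disj (C : {set V}) : C \subset W -> #|A :|: C| = (#|A| + #|C|)%N.
    move=> CW; rewrite cardsU disjoint_setI0 ?cards0 ?subn0 //.
    exact: disjointWr CW dAW.
  have [|K [iK tK KU cK]] := indep_augment iAt iB.
    by rewrite !disj // ?sub_v // ct; lia.
  have vK : v \notin K.
    apply: contra niv => vK; apply: indepS iK _.
    by rewrite subUset sub1set vK.
  have AK : A \subset K by apply: subset_trans tK; apply: subsetUl.
  exists (K :\: A); apply/and3P; split.
  + rewrite subsetD1 !inE (negPf vK) andbF andbT subDset.
    apply: subset_trans KU _; rewrite !subUset subsetUl /=.
    by rewrite (subset_trans (sub_v _ tW)) ?(subset_trans BW) ?subsetUr.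
  + by rewrite setDE setUIr setUCr setIT (setUidPr AK).
  by rewrite cardsDS // cK disj // addKn.
- by rewrite (cardsD1 v) vt ct.
Qed.

End MatroidHomology.

(** * Chain maps on the cubical complex and the trace argument *)

Section FreeChainMaps.
Import GRing.Theory.
Local Open Scope ring_scope.
Variables (V : finType) (F : fieldType) (X : {set {set V}}).
Hypothesis XS : simplicial_complex X.
Implicit Types (r s t : {set V}).

Local Notation chain := {ffun {set V} -> F^o}.
Local Notation bd := (boundary V F).

(* The image under f of the boundary of the cube [r, s]. For a point [r = s] the
   boundary is the empty face, so that f preserves augmentations. *)
Definition cube_boundary (f : {set V} -> {set V} -> chain) r s : chain :=
  (if r == s then face_chain F set0 else 0) +
  \sum_(v in s :\: r) sgn F v (s :\: r) *: (f (v |: r) s - f r (s :\ v)).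

Definition is_chain_map_at f r s := bd (f r s) = cube_boundary f r s.

Lemma setDU1 r s v : s :\: (v |: r) = (s :\: r) :\ v.
Proof. by rewrite setUC setDDl. Qed.

Lemma setD1D r s v : (s :\ v) :\: r = (s :\: r) :\ v.
Proof. by rewrite !setDDl setUC. Qed.

(** The double boundary sums [G v w], a combination of the four codimension-2 faces in directions
    [v] and [w]. It is symmetric while the signs are antisymmetric. The augmentation terms of
    opposite facets cancel, since both facets are points or neither is. *)
Lemma cube_boundary_cycle f r s : r \subset s ->
  (forall v, v \in s :\: r -> is_chain_map_at f (v |: r) s /\ is_chain_map_at f r (s :\ v)) ->
  bd (cube_boundary f r s) = 0.
Proof.
move=> rs fP; rewrite /cube_boundary linearD /=.
have -> : bd (if r == s then face_chain F set0 else 0) = 0.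
  by case: ifP => _; rewrite ?boundary_face0 ?linear0.
rewrite add0r linear_sum /=.
pose D := s :\: r.
pose G v w := f (w |: (v |: r)) s - f (v |: r) (s :\ w)
              - (f (w |: r) (s :\ v) - f r (s :\ v :\ w)).
rewrite (eq_bigr (fun v => \sum_(w in D :\ v) (sgn F v D * sgn F w (D :\ v)) *: G v w)).
  apply: sum_antisym => v w vD wD ne; rewrite sgn_swap // scaleNr; congr (- (_ *: _)).
  rewrite /G (setUCA [set w]) (setDDl s) (setDDl s) (setUC [set w] [set v]).
  by rewrite !opprD !opprK !addrA; congr (_ + _); rewrite addrAC.
move=> v vD; rewrite linearZ linearB /=; have [-> ->] := fP v vD.
rewrite /cube_boundary setDU1 setD1D -/D.
have -> : (v |: r == s) = (r == s :\ v).
  move: vD; rewrite inE => /andP[vr vs]; apply/eqP/eqP => [<-|->].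
    by rewrite setU1K.
  by rewrite setD1K.
rewrite opprD addrACA subrr add0r -sumrB scaler_sumr.
by apply: eq_bigr => w _; rewrite -scalerBr scalerA.
Qed.

(* Compare, with signs, the diagonal coefficients of [s |-> bd (f set0 s)]
   computed from the definition of the boundary and from the cube relation: they
   cancel in pairs, except for the one at the empty face. *)
Lemma no_free_chain_map f : set0 \in X ->
  (forall r s, s \in X -> r \subset s -> is_chain_map_at f r s) ->
  (forall r s t, s \in X -> r \subset s -> f r s t != 0 -> t \in X /\ [disjoint t & r]) ->
  False.
Proof.
move=> X0 fE fS.
pose a s v : F := sgn F v (v |: s) * f set0 s (v |: s).
pose sg s : F := (-1) ^+ #|s|.
pose L := \sum_(s in X) \sum_(v | v \notin s) sg s * a s v.
(* Reindex by [(s, v) |-> (v |: s, v)], which flips [sg]; summands with [v |: s] outside [X] vanish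
   because [f set0 s] is a chain of [X]. *)
have L1 : L = \sum_(s in X) \sum_(v in s) - (sg s * a (s :\ v) v).
  rewrite /L (exchange_big_dep xpredT) //= [RHS](exchange_big_dep xpredT) //=.
  apply: eq_bigr => v _.
  rewrite [RHS](reindex_onto (fun s => v |: s) (fun s => s :\ v)) /=; last first.
    by move=> s /andP[_ vs]; rewrite setD1K.
  rewrite (bigID (fun s => v |: s \in X)) /= [X in _ + X]big1 ?addr0; last first.
    move=> s /andP[/andP[sX vs] vsX]; rewrite /a.
    suff -> : f set0 s (v |: s) = 0 by rewrite !mulr0.
    apply/eqP; apply: contraNT vsX => /fS[] //; exact: sub0set.
  apply: eq_big => [s|s /andP[/andP[sX vs] vsX]].
    rewrite setU11 andbT; have [vs|vs] := boolP (v \in s); last first.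
      rewrite setU1K // eqxx !andbT; apply: andb_idl => vsX.
      by apply: XS vsX (subsetUr _ _).
    rewrite andbF; apply/esym/negbTE; rewrite negb_and orbC; apply/orP; left.
    by apply: contraTneq vs => <-; rewrite !inE eqxx.
  by rewrite setU1K // /sg cardsU1 vs exprS mulN1r mulNr opprK.
have dE s : s \in X -> \sum_(v | v \notin s) a s v =
    (s == set0)%:R - \sum_(v in s) a (s :\ v) v.
  move=> sX; have := congr1 (fun c : chain => c s) (fE _ _ sX (sub0set s)).
  rewrite /= boundaryE => ->.
  rewrite /cube_boundary ffunE setD0 sum_ffunE eq_sym; congr (_ + _).
    by case: eqP => [->|]; rewrite ffunE ?eqxx.
  rewrite -sumrN; apply: eq_bigr => v vs; rewrite /a setD1K // !ffunE.
  (* Freeness enters here: the chain for the cell from [v] to [s] avoids [v], so it does not involve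
     [s]. *)
  have -> : f (v |: set0) s s = 0.
    apply/eqP; apply: contraTT isT => nz.
    have [|_] := fS _ _ _ sX _ nz; first by rewrite setU0 sub1set.
    by move/disjointFl=> /(_ v); rewrite setU11 vs => /(_ isT).
  by rewrite sub0r scalerN.
have : L = 1 + L.
  rewrite {1}/L.
  under eq_bigr => s sX do rewrite -mulr_sumr (dE s sX) mulrBr.
  rewrite big_split /= (bigD1 set0) //= eqxx /sg cards0 mulr1 big1 ?addr0.
    rewrite L1; congr (_ + _); apply: eq_bigr => s _.
    by rewrite mulr_sumr -sumrN.
  by move=> s /andP[_ /negPf->]; rewrite mulr0.
move/eqP; rewrite -subr_eq0 opprD addrCA subrr addr0 oppr_eq0.
by rewrite oner_eq0.
Qed.

(** Membership in [I] stops below dimension [d]: the filling in dimension [d] still has its boundary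
    in [I], but is itself only required to lie in [X]. *)
Definition carried (d : nat) (I : {set {set V}}) r s (c : chain) :=
  forall t, c t != 0 -> [/\ t \in X, [disjoint t & r], #|t| = #|s :\: r|.+1 &
    (#|s :\: r| < d)%N -> t \in I].

(** Induction on the cell dimension: the boundary of a new cell is a cycle carried by the cells
    already treated, and the hypothesis fills it. *)
Lemma free_chain_map_exists d (I : {set {set V}}) :
  set0 \in X -> set0 \in I ->
  (forall r s (z : chain), s \in X -> r \subset s -> bd z = 0 ->
    (forall t, z t != 0 -> [/\ t \in X, [disjoint t & r], #|t| = #|s :\: r| &
      (#|s :\: r| <= d)%N -> t \in I]) ->
    exists2 c, bd c = z & carried d I r s c) ->
  exists f, forall r s, s \in X -> r \subset s ->
    is_chain_map_at f r s /\ carried d I r s (f r s).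
Proof.
move=> X0 I0 fill.
suff H n : exists f, forall r s, s \in X -> r \subset s -> (#|s :\: r| < n)%N ->
    is_chain_map_at f r s /\ carried d I r s (f r s).
  have [f fP] := H #|V|.+1; exists f => r s sX rs; apply: fP => //.
  by rewrite ltnS max_card.
have cD r s v : v \in s :\: r -> #|s :\: r| = #|(s :\: r) :\ v|.+1.
  by move=> vD; rewrite (cardsD1 v) vD.
elim: n => [|n [f fP]]; first by exists (fun _ _ => 0).
have step (p : {set V} * {set V}) : exists c : chain,
    p.2 \in X -> p.1 \subset p.2 -> #|p.2 :\: p.1| = n ->
    bd c = cube_boundary f p.1 p.2 /\ carried d I p.1 p.2 c.
  case: p => r s /=; have [|] := boolP [&& s \in X, r \subset s & #|s :\: r| == n]; last first.
    by move=> no; exists 0 => sX rs /eqP e; rewrite sX rs e in no.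
  move=> /and3P[sX rs /eqP cn].
  have sub v : v \in s :\: r -> [/\ (v |: r) \subset s, r \subset s :\ v,
      s :\ v \in X & (#|(s :\: r) :\ v| < n)%N].
    move=> vD; have := vD; rewrite inE => /andP[vr vs]; split.
    - by rewrite subUset sub1set vs.
    - by rewrite subsetD1 rs.
    - by apply: XS sX (subD1set _ _).
    - by rewrite -cn (cD _ _ _ vD).
  have z0 : bd (cube_boundary f r s) = 0.
    apply: cube_boundary_cycle => // v /sub[vrs rsv sX' lt_n].
    by split; apply: (proj1 (fP _ _ _ _ _)); rewrite ?setDU1 ?setD1D.
  have [|c cE cC] := fill r s (cube_boundary f r s) sX rs z0; last by exists c.
  move=> t /add_nz[].
    case: (r =P s) => [<- /face_nz ->|_]; last by rewrite ffunE eqxx.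
    by rewrite setDv cards0; split=> //; rewrite -setI_eq0 set0I.
  case/sum_nz => v vD /scale_nz.
  have [vrs rsv sX' lt_n] := sub v vD.
  rewrite (cD _ _ _ vD); case/add_nz => [|/opp_nz].
    have [|_ C nz] := fP _ _ sX vrs; first by rewrite setDU1.
    have [tX dt ct tI] := C _ nz; rewrite setDU1 in ct tI.
    by split=> //; apply: disjointWr dt; exact: subsetUr.
  have [|_ C nz] := fP _ _ sX' rsv; first by rewrite setD1D.
  by have [tX dt ct tI] := C _ nz; rewrite setD1D in ct tI.
have [g gP] := fin_all_exists step.
(* Only cells of dimension [n] change, so boundaries of cells of dimension at most [n] stay the
   same. *)
pose f' r s := if #|s :\: r| == n then g (r, s) else f r s.
exists f' => r s sX rs.
have cb : (#|s :\: r| <= n)%N -> cube_boundary f' r s = cube_boundary f r s.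
  move=> le_n; congr (_ + _); apply: eq_bigr => v vD.
  rewrite /f' setDU1 setD1D.
  by have /negPf -> : #|(s :\: r) :\ v| != n by move: le_n; rewrite (cD _ _ _ vD); lia.
rewrite ltnS => le_n; rewrite /is_chain_map_at cb //.
rewrite /f'; have [e|ne] := eqVneq #|s :\: r| n; first exact: (gP (r, s)).
by apply: fP => //; lia.
Qed.

End FreeChainMaps.

(** * Leray fillings and replacement of simplices *)

Section LerayFilling.
Import GRing.Theory.
Local Open Scope ring_scope.
Variables (V : finType) (F : fieldType).
Implicit Types (X : {set {set V}}) (t u W : {set V}).

Local Notation chain := {ffun {set V} -> F^o}.
Local Notation bd := (boundary V F).

Lemma chainsP X n (c : chain) :
  reflect (forall t, c t != 0 -> t \in X /\ #|t| = n) (c \in chains F X n).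
Proof.
apply: (iffP idP) => [|cS].
  rewrite /chains -[X in <<X>>%VS]in_tupleE => /coord_span -> t /sum_nz[i _ /scale_nz].
  set l := [seq _ | s <- _ & _] in i *.
  have /mapP[s] : l`_i \in l by rewrite mem_nth.
  by rewrite mem_filter mem_enum => /andP[/eqP cs sX] -> /face_nz ->.
rewrite (chain_sum c); apply: memv_suml => t _.
have [->|/cS[tX ct]] := eqVneq (c t) 0; first by rewrite scale0r mem0v.
apply/memvZ/memv_span/map_f.
by rewrite mem_filter mem_enum tX ct eqxx.
Qed.

(** Faces with [n] elements have degree [n - 1], so [d < n] is exactly the range of the Leray
    property. *)
Lemma Leray_fill d X W n (z : chain) : Leray F d X -> (d < n)%N -> bd z = 0 ->
  (forall t, z t != 0 -> [/\ t \in X, t \subset W & #|t| = n]) ->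
  exists2 c, bd c = z &
    forall t, c t != 0 -> [/\ t \in X, t \subset W & #|t| = n.+1].
Proof.
move=> LX; case: n => // n le_dn z0 zS.
have /memv_imgP[c cC ->] : z \in boundaries F (induced X W) n.+1.
  apply: (subvP (LX W n le_dn)); rewrite memv_cap memv_ker z0 eqxx andbT.
  by apply/chainsP => t /zS[tX tW ct]; rewrite inE tX.
by exists c => // t; move/chainsP: cC => /[apply]; rewrite inE => -[/andP[]].
Qed.

(** The witness is the cone from [v] over the boundary of [u]: that boundary is a cycle, so coning
    it gives it back as boundary, and only [v] joined to facets of [u] occurs. *)
Lemma cone_face X u v W : simplicial_complex X -> v \in W -> u \subset W ->
  v \notin u -> (forall s : {set V}, s \proper u -> v |: s \in X) ->
  exists2 c, bd c = bd (face_chain F u) &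
    forall t, c t != 0 -> [/\ t \in X, t \subset W & #|t| = #|u|].
Proof.
move=> XS vW uW vu vX.
have dS t : bd (face_chain F u) t != 0 -> exists2 w, w \in u & t = u :\ w.
  by case/boundary_nz => w wt /face_nz <-; exists w; rewrite ?setU11 ?setU1K.
exists (cone v (bd (face_chain F u))).
  rewrite boundary_cone ?boundary_boundary_face; last first.
    by move=> t /dS[w _ ->]; rewrite inE negb_and vu orbT.
  by apply/ffunP=> t; rewrite !ffunE mulr0 if_same; apply: subr0.
move=> t /cone_nz[vt /dS[w wu e]]; rewrite -(setD1K vt) e; split.
- exact/vX/properD1.
- by rewrite subUset sub1set vW (subset_trans (subD1set _ _)).
by rewrite cardsU1 !inE negb_and vu orbT (cardsD1 w u) wu.
Qed.

Lemma boundary_replace_faces (c : chain) (Q : {set V} -> Prop) :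
  (forall u, c u != 0 -> exists2 c', bd c' = bd (face_chain F u) &
    forall t, c' t != 0 -> Q t) ->
  exists2 c', bd c' = bd c & forall t, c' t != 0 -> Q t.
Proof.
move=> repl.
have [u|g gP] := @fin_all_exists _ (fun=> chain) (fun u c' => c u != 0 ->
    bd c' = bd (face_chain F u) /\ forall t, c' t != 0 -> Q t).
  by have [_|/repl[c' c'E c'Q]] := eqVneq (c u) 0; [exists 0 | exists c'].
exists (\sum_(u | c u != 0) (c u : F) *: g u); last first.
  by move=> t /sum_nz[u cu /scale_nz]; have [_ /[apply]] := gP u cu.
rewrite [c in RHS]chain_sum !linear_sum /=.
rewrite [RHS](bigID (fun u => c u != 0)) /= [X in _ + X]big1 ?addr0.
  by apply: eq_bigr => u cu; rewrite !linearZ /=; case: (gP u cu) => ->.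
by move=> u; rewrite negbK => /eqP ->; rewrite scale0r linear0.
Qed.

End LerayFilling.

(** * Combining matroid and Leray fillings *)

Section Main.
Variables (F : fieldType) (V : finType) (d m k : nat).
Variables (X : {set {set V}}) (M : matroid V).
Implicit Types (A B r s t u W : {set V}).
Hypotheses (m_gt0 : 0 < m) (le_mk : m <= k) (le_kmd : k <= m + d).
Hypotheses (le_mdV : m + d <= #|V|) (le_kr : k <= rank M setT).
Hypotheses (XS : simplicial_complex X) (LX : Leray F d X).
Hypothesis XM : forall A B, [disjoint A & B] -> #|A| = d.+1 -> #|B| = m.-1 ->
  k <= rank M (A :|: B) ->
  A \in X \/ exists2 v, v \in B & forall s : {set V}, s \proper A -> v |: s \in X.

(** With this excess, a set of [m + d] elements is independent in [N] exactly when its rank in [M]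
    is at least [k]. *)
Let N := elongation M (m + d - k).

Let ke : k + (m + d - k) = m + d. Proof. exact: subnKC. Qed.

(** Extend [u] to [m + d] elements of rank at least [k], then cut off [d + 1] of them including [u];
    the two pieces have the shape required by [XM]. *)
Lemma indep_extend_split W u : u \in indep N -> u \subset W -> #|u| <= d.+1 ->
  m + d <= #|W| -> k <= rank M W ->
  exists A B, [/\ [disjoint A & B], u \subset A, A :|: B \subset W,
    #|A| = d.+1 & #|B| = m.-1 /\ k <= rank M (A :|: B)].
Proof.
move=> iu uW cu cW kW.
have [||C [uC CW cC kC]] := elongation_extend iu uW _ _ kW; rewrite ?ke //.
  by lia.
have [|D DC cD] := @exists_subset_card _ (C :\: u) (d.+1 - #|u|).
  by rewrite cardsDS // cC ke; lia.
have [DC' duD] : D \subset C /\ [disjoint D & u].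
  by apply/andP; rewrite -subsetD.
have uDC : u :|: D \subset C by rewrite subUset uC.
have cuD : #|u :|: D| = d.+1.
  by rewrite cardsU disjoint_setI0 1?disjoint_sym // cards0 cD; lia.
exists (u :|: D), (C :\: (u :|: D)).
have e : (u :|: D) :|: (C :\: (u :|: D)) = C.
  by rewrite setDE setUIr setUCr setIT; apply/setUidPr.
rewrite e; split; rewrite ?subsetUl ?cuD ?cardsDS //.
  by rewrite disjoints_subset setCD subsetUr.
by split=> //; rewrite cuD cC ke; lia.
Qed.

(** Either [A] is a face and contains [u], or [u] is a proper subset of [A] by its size and [v |: u]
    is a face. *)
Lemma small_indep_face u : u \in indep N -> #|u| <= d -> u \in X.
Proof.
move=> iu cu.
have [||A [B [dAB uA _ cA [cB kAB]]]] := indep_extend_split iu (subsetT u) (leqW cu).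
- by rewrite cardsT.
- by [].
have [/XS|[v _ /(_ u)]] := XM dAB cA cB kAB; first exact.
rewrite properEcard uA cA ltnS cu => /(_ isT)/XS; apply; exact: subsetUr.
Qed.

Lemma exists_small_corank_face : exists2 t, t \in X & rank M (~: t) < k.
Proof.
have [/existsP[t /andP[tX lt]]|no] := boolP [exists t in X, rank M (~: t) < k].
  by exists t.
have kX t : t \in X -> k <= rank M (~: t).
  by move=> tX; rewrite leqNgt; apply: contra no => lt; apply/existsP; exists t; rewrite tX.
have X0 : set0 \in X by rewrite small_indep_face ?indep0 ?cards0.
have rank_card W : rank M W <= #|W|.
  by have [I [_ /subset_leq_card ? <-]] := rank_basis M W.
have [||r s z sX rs z0 zS|f fP] := @free_chain_map_exists _ F X XS d (indep N) => //.
- exact: indep0.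
- have cW : #|~: r| = #|s :\: r| + #|~: s|.
    have := cardsC r; have := cardsC s; have := cardsDS rs; have := subset_leq_card rs.
    lia.
  have kW := kX _ (XS sX rs).
  (* Together with [cW] this makes [~: r] large: it exceeds [#|s :\: r|] by at least [k], hence has
     at least [m + d] elements when the cell has dimension [d]. *)
  have ks : k <= #|~: s| := leq_trans (kX _ sX) (rank_card _).
  have [le_d|lt_d] := leqP #|s :\: r| d; last first.
    have [|c cE cS] := @Leray_fill _ F d X (~: r) #|s :\: r| z LX lt_d z0.
      by move=> t /zS[tX dtr ct _]; rewrite -disjoints_subset.
    exists c => // t /cS[tX]; rewrite -disjoints_subset => dtr ct.
    by split=> //; rewrite ltnNge (ltnW lt_d).
  have [|t /zS[tX dtr ct /(_ le_d) tI]||c cE cS] :=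
      @matroid_acyclic _ F N set0 (~: r) #|s :\: r| z _ z0.
  + by rewrite -setI_eq0 set0I.
  + by rewrite set0U -disjoints_subset.
  + have [B [iB BW cB]] := elongation_subset (m + d - k) kW.
    exists B; rewrite set0U; split=> //; rewrite cB ke; lia.
  have [lt_d|eq_d] : #|s :\: r| < d \/ #|s :\: r| = d by lia.
    exists c => // t /cS[]; rewrite set0U -disjoints_subset => dtr tI ct.
    by split=> //; apply: small_indep_face => //; rewrite ct.
  (* In dimension [d] the simplices of the filling have [d + 1] elements, too many for
     [small_indep_face]; those outside [X] are replaced without changing the boundary. *)
  have [u /cS[uW]|c' c'E c'S] := @boundary_replace_faces _ F c
      (fun t => [/\ t \in X, t \subset ~: r & #|t| = d.+1]).
    rewrite set0U eq_d => iu cu.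
    have [uX|uX] := boolP (u \in X).
      by exists (face_chain F u) => // t /face_nz ->.
    have [||A [B [dAB uA ABW cA [cB kAB]]]] := indep_extend_split iu uW _ _ kW.
    - by rewrite cu.
    - by rewrite cW; lia.
    (* Since [u] already has [d + 1] elements, the split adds nothing to it, and [XM] speaks of [u]
       itself. *)
    have eA : A = u by apply/esym/eqP; rewrite eqEcard uA cA cu leqnn.
    rewrite {}eA in dAB cA kAB ABW.
    have [uX'|[v vB vX]] := XM dAB cA cB kAB; first by rewrite uX' in uX.
    have vu : v \notin u by rewrite (disjointFl dAB vB).
    have vW : v \in ~: r by apply: (subsetP ABW); rewrite inE vB orbT.
    have [c' c'E c'S] := @cone_face _ F X u v _ XS vW uW vu vX.
    by exists c' => // t /c'S; rewrite cu.
  exists c'; first by rewrite c'E cE.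
  move=> t /c'S[tX tr ct]; split=> //; first by rewrite disjoints_subset.
    by rewrite eq_d.
  by rewrite eq_d ltnn.
case: (@no_free_chain_map _ F X XS f X0) => [r s sX rs|r s t sX rs].
  by case: (fP r s sX rs).
by case: (fP r s sX rs) => _ /[apply] -[].
Qed.

End Main.

Theorem theorem1p7 (F : fieldType) (V : finType) (d r m k : nat)
    (X : {set {set V}}) (M : matroid V) :
  1 <= d -> d + 1 <= r -> 1 <= m <= r -> m <= k <= minn (m + d) r ->
  maxn (m + d) r <= #|V| ->
  simplicial_complex X -> Leray F d X ->
  rank M [set: V] = r ->
  (forall (u : (d + 1).-tuple V) (v : (m - 1).-tuple V),
      uniq (u ++ v) -> k <= rank M [set x in u ++ v] ->
      [set x in u] \in X \/
      exists j : 'I_(m - 1),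
        forall s : {set V}, s \proper [set x in u] -> s :|: [set tnth v j] \in X) ->
  exists2 t : {set V}, t \in X & rank M ([set: V] :\: t) <= k - 1.
Proof.
move=> _ _ /andP[m_gt0 _] /andP[le_mk]; rewrite leq_min => /andP[le_kmd le_kr].
rewrite geq_max => /andP[le_mdV _] XS LX rM XM.
have [||t tX lt_k] := @exists_small_corank_face F V d m k X M m_gt0 le_mk le_kmd le_mdV _ XS LX.
- by rewrite rM.
- move=> A B dAB cA cB kAB.
  have sA : size (enum A) == d + 1 by rewrite -cardE cA addn1.
  have sB : size (enum B) == m - 1 by rewrite -cardE cB subn1.
  have eA : [set x in Tuple sA] = A by apply/setP=> x; rewrite inE mem_enum.
  have [||AX|[j jX]] := XM (Tuple sA) (Tuple sB).
  + rewrite cat_uniq !enum_uniq andbT /=; apply/hasPn=> x; rewrite !mem_enum => xB.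
    by rewrite (disjointFl dAB xB).
  + suff -> : [set x in Tuple sA ++ Tuple sB] = A :|: B by [].
    by apply/setP=> x; rewrite !inE mem_cat !mem_enum.
  + by left; rewrite eA in AX.
  right; exists (tnth (Tuple sB) j); first by rewrite -mem_enum (mem_tnth j (Tuple sB)).
  by move=> s; rewrite -eA setUC; apply: jX.
by exists t => //; rewrite setTD; lia.
Qed.
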